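(* Suppose $u$ (the exact solution) and $\mathcal U$ are both smooth functions. For the numerical solution of the forward Euler DG scheme $u_h^{n+1,(\mathrm{pre})}=u_h^n+\Delta t\,\mathcal L_h(u_h^n)$, under the following assumptions: 1. $\partial_x^qu_h^n(x)-\partial_x^qu(x,t^n)=\mathcal O(\Delta x^{k+1-q})$, $q=0,\dots,k$; 2. $\partial_x^q\mathcal L_h(u_h^n)(x)-\partial_x^q\partial_tu(x,t^n)=\mathcal O(\Delta x^{k+1-q})$, $q=0,\dots,k$; 3. $\mathcal U(u_h^{n+1,(\mathrm{pre})}(x))-\mathcal U(u_h^n(x))=\Delta t\cdot\mathcal U'(u_h^n(x))\,\mathcal L_h(u_h^n)(x)+\mathcal O(\Delta t^2)$; we have the estimate $$\mathcal U^{\mathrm{high}}-\mathcal U^{\mathrm{up}}=\mathcal O\big(\Delta x^{2k+1}\Delta t+\Delta x^{2N-2}\Delta t+\Delta t^2\big),$$ where, on a cell $I_i$, $\mathcal U^{\mathrm{high}}=\tilde{\mathcal U}_i^{n+1,(\mathrm{pre})}$ and $\mathcal U^{\mathrm{up}}=\tilde{\mathcal U}_i^n-\lambda\big(\hat{\mathcal F}_{i+1/2}-\hat{\mathcal F}_{i-1/2}\big)$.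
   Context: Scalar conservation law $u_t+f(u)_x=0$, $x\in\mathbb R$, $t>0$. Uniform mesh: $\mathbb R=\bigcup_{i\in\mathbb Z}I_i$, $I_i=[x_{i-1/2},x_{i+1/2}]$ of length $\Delta x$; $t^n=n\Delta t$, $\lambda=\Delta t/\Delta x$. $V_h^k$ is the space of functions whose restriction to each $I_i$ is a polynomial of degree at most $k$; $u_h^n\in V_h^k$; $w_{i+1/2}^{-}$, $w_{i+1/2}^{+}$ are the traces of $w$ at $x_{i+1/2}$ from $I_i$ and $I_{i+1}$. Numerical flux: $\hat f(u^-,u^+)$ is a consistent, Lipschitz continuous and monotone numerical flux (nondecreasing in $u^-$, nonincreasing in $u^+$). The flux employed is the Lax–Friedrichs flux $\hat f(u^-,u^+)=\frac12(f(u^+)+f(u^-))-\frac12\alpha(u^+-u^-)$, $\alpha=\max|f'(u)|$ over $u$ between $u^-$ and $u^+$. With $\hat f_{i+1/2}=\hat f(u_{h,i+1/2}^-,u_{h,i+1/2}^+)$, the DG operator $\mathcal L_h(u_h)\in V_h^k$ is defined by $$\int_{I_i}\mathcal L_h(u_h)\,w\,dx=\int_{I_i}f(u_h)w_x\,dx-\hat f_{i+1/2}w_{i+1/2}^-+\hat f_{i-1/2}w_{i-1/2}^+\quad\forall w\in V_h^k,\ \forall i.$$ Entropy pair: $\mathcal U$ convex, $\mathcal F'=\mathcal U'f'$. $\hat{\mathcal F}(u^-,u^+)$ is a proper numerical entropy flux associated with $\hat f$: $\hat{\mathcal F}(u,u)=\mathcal F(u)$ and $\partial\hat{\mathcal F}/\partial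 u^\pm=\mathcal U'(u^\pm)\,\partial\hat f/\partial u^\pm$ (for the Lax–Friedrichs flux, $\hat{\mathcal F}(u^-,u^+)=\frac12(\mathcal F(u^+)+\mathcal F(u^-))-\frac12\alpha(\mathcal U(u^+)-\mathcal U(u^-))$); $\hat{\mathcal F}_{i+1/2}=\hat{\mathcal F}(u_{i+1/2}^{n,-},u_{i+1/2}^{n,+})$, evaluated at the traces of $u_h^n$. Quadrature: $2N-3\ge k$; $\int_{I_i}^{\langle N\rangle}g\,dx=\Delta x\sum_{q=1}^N\omega_q g(\hat x_{i,q})$ is the $N$-point Gauss–Lobatto rule on $I_i$, with weights normalized so that $\sum_q\omega_q=1$. $\tilde{\mathcal U}_i^n=\frac1{\Delta x}\int_{I_i}^{\langle N\rangle}\mathcal U(u_h^n)\,dx$ and $\tilde{\mathcal U}_i^{n+1,(\mathrm{pre})}=\frac1{\Delta x}\int_{I_i}^{\langle N\rangle}\mathcal U(u_h^{n+1,(\mathrm{pre})})\,dx$. *)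

(* Defs.v *)
From HB Require Import structures.
From mathcomp Require Import all_boot all_order all_algebra.
From mathcomp Require Import all_classical all_reals all_analysis.

Set Implicit Arguments.
Unset Strict Implicit.
Unset Printing Implicit Defensive.

Import Order.TTheory GRing.Theory Num.Theory.
Import numFieldNormedType.Exports.

Local Open Scope classical_set_scope.
Local Open Scope ring_scope.

Section Smooth.
Context {R : realType} {V W : normedModType R}.

Definition iter_derive (vs : seq V) (g : V -> W) : V -> W :=
  foldr (fun v h z => 'D_v h z) g vs.

(* For finite-dimensional V this is C^oo on an open neighbourhood of S, the
   usual meaning of smoothness on a set S that need not be open. *)
Definition smooth_on (S : set V) (g : V -> W) : Prop :=
  exists O : set V, [/\ open O, S `<=` O &
    forall vs z, O z -> differentiable (iter_derive vs g) z].

End Smooth.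

Definition C1 {R : realType} (f : R -> R) : Prop :=
  (forall w : R, derivable f w 1) /\ continuous (derive1 f).

Section ConservationLaw.
Context {R : realType}.

(* Functions of (x, t) are functions on R * R. *)
Definition dx_iter (q : nat) (u : R * R -> R) : R * R -> R :=
  iter_derive (nseq q ((1, 0) : R * R)) u.
Definition dt_once (u : R * R -> R) : R * R -> R := iter_derive [:: ((0, 1) : R * R)] u.

Definition slab (A : set R) (T : R) : set (R * R) := A `*` `[0, T].

Definition exact_solution (f : R -> R) (T : R) (u : R * R -> R) : Prop :=
  smooth_on (slab setT T) u /\
  forall x t, 0 < t -> t <= T ->
    dt_once u (x, t) + derive1 (fun y => f (u (y, t))) x = 0.

(* On such a region the constants hidden in O(...) can be uniform. Compact
   regions always qualify (lemma below); the whole line does when, e.g.,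
   u is periodic in x. *)
Definition bounded_derivatives (A : set R) (T : R) (u : R * R -> R) : Prop :=
  forall vs, exists M : R, forall z, slab A T z -> `|iter_derive vs u z| <= M.

Lemma compact_bounded_derivatives (A : set R) (T : R) (u : R * R -> R) :
  smooth_on (slab setT T) u -> compact A -> bounded_derivatives A T u.
Proof.
case=> O [_ SO uO] cA vs.
have cK : compact (slab A T).
  by apply: compact_setX => //; exact: segment_compact.
have KO : slab A T `<=` O.
  by move=> z [_ zT]; apply: SO; split.
have cu : {within slab A T, continuous (iter_derive vs u)}.
  apply: continuous_in_subspaceT => z; rewrite inE => /KO Oz.
  exact: differentiable_continuous (uO vs z Oz).
have /compact_bounded [M [_ Mb]] := continuous_compact cu cK.
exists (M + 1) => z Kz; apply: (Mb (M + 1)); first by rewrite ltrDl ltr01.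
by exists z.
Qed.

Definition entropy_pair (f U F : R -> R) : Prop :=
  [/\ smooth_on setT U, convex_function [set: R] U &
      forall w : R, is_derive w 1 F (derive1 U w * derive1 f w)].

End ConservationLaw.

Section NumericalFlux.
Context {R : realType}.
Implicit Types (f U F : R -> R) (fhat Fhat : R -> R -> R).

Definition locally_lipschitz fhat : Prop :=
  forall M : R, exists L : R, forall a b c d : R,
    `|a| <= M -> `|b| <= M -> `|c| <= M -> `|d| <= M ->
    `|fhat a b - fhat c d| <= L * (`|a - c| + `|b - d|).

Record monotone_flux f fhat : Prop := MonotoneFlux {
  flux_consistent : forall w, fhat w w = f w ;
  flux_lipschitz : locally_lipschitz fhat ;
  flux_nondecreasing : forall b, {homo fhat^~ b : a c / a <= c} ;
  flux_nonincreasing : forall a, {homo fhat a : b d / b <= d >-> d <= b} }.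

Record proper_entropy_flux U F fhat Fhat : Prop := ProperEntropyFlux {
  entropy_flux_consistent : forall w, Fhat w w = F w ;
  flux_derivable_l : forall a b : R, derivable (fhat^~ b) a 1 ;
  flux_derivable_r : forall a b : R, derivable (fhat a) b 1 ;
  entropy_flux_derive_l : forall a b : R,
    is_derive a 1 (Fhat^~ b) (derive1 U a * derive1 (fhat^~ b) a) ;
  entropy_flux_derive_r : forall a b : R,
    is_derive b 1 (Fhat a) (derive1 U b * derive1 (fhat a) b) }.

Definition LF_speed f (a b : R) : R :=
  sup [set `|derive1 f w| | w in `[Num.min a b, Num.max a b]].

Definition LF_flux f (a b : R) : R :=
  2^-1 * (f b + f a) - 2^-1 * LF_speed f a b * (b - a).

Definition LF_entropy_flux f U F (a b : R) : R :=
  2^-1 * (F b + F a) - 2^-1 * LF_speed f a b * (U b - U a).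

(* The Lax-Friedrichs pair is a separate case: its speed depends on both states,
   so it satisfies the derivative relations only with that speed frozen. *)
Definition admissible_flux f U F fhat Fhat : Prop :=
  (monotone_flux f fhat /\ proper_entropy_flux U F fhat Fhat) \/
  (fhat =2 LF_flux f /\ Fhat =2 LF_entropy_flux f U F).

End NumericalFlux.

Record mesh (R : realType) := Mesh { mesh_origin : R ; mesh_size : R }.

Section DG.
Context {R : realType}.
Implicit Types (m : mesh R) (i : int) (w uh : int -> {poly R}).

(* edge m i is the left end point x_{i-1/2} of the cell I_i. *)
Definition edge m i : R := mesh_origin m + i%:~R * mesh_size m.
Definition cell m i : set R := `[edge m i, edge m (i + 1)].

(* A piecewise polynomial is the family of its polynomials (in the global
   variable x) on the cells; it is two-valued at the cell interfaces. *)
Definition Vh (k : nat) w : Prop := forall i, (size (w i) <= k.+1)%N.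

(* Traces at x_{i+1/2}. *)
Definition trace_minus m w i : R := (w i).[edge m (i + 1)].
Definition trace_plus m w i : R := (w (i + 1)).[edge m (i + 1)].

(* g(w^-, w^+) at x_{i+1/2}. *)
Definition at_interface m (g : R -> R -> R) w i : R :=
  g (trace_minus m w i) (trace_plus m w i).

Definition is_DG_operator (f : R -> R) (fhat : R -> R -> R) m (k : nat)
    uh (Lh : int -> {poly R}) : Prop :=
  Vh k Lh /\
  forall w, Vh k w -> forall i,
    \int[lebesgue_measure]_(x in cell m i) ((Lh i).[x] * (w i).[x]) =
    \int[lebesgue_measure]_(x in cell m i) (f (uh i).[x] * ((w i)^`()).[x])
    - at_interface m fhat uh i * trace_minus m w i
    + at_interface m fhat uh (i - 1) * trace_plus m w (i - 1).

Definition euler_step (dt : R) uh (Lh : int -> {poly R}) : int -> {poly R} :=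
  fun i => uh i + dt *: Lh i.

(* N-point Gauss-Lobatto rule on [0, 1]: both end points are nodes and the
   degree of exactness is 2N - 3, which determines the rule. The weights sum
   to 1 by exactness on constants. *)
Definition gauss_lobatto (N : nat) (xi omega : 'I_N -> R) : Prop :=
  [/\ forall q r : 'I_N, (q < r)%N -> xi q < xi r,
      forall q : 'I_N, q = 0%N :> nat -> xi q = 0,
      forall q : 'I_N, q = N.-1 :> nat -> xi q = 1 &
      forall p : {poly R}, (size p <= 2 * N - 2)%N ->
        \sum_(q < N) omega q * p.[xi q] =
        \int[lebesgue_measure]_(x in `[0, 1]) p.[x]].

Definition cell_quadrature (N : nat) (xi omega : 'I_N -> R) m i (g : R -> R) : R :=
  mesh_size m * \sum_(q < N) omega q * g (edge m i + mesh_size m * xi q).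

Definition cell_entropy (N : nat) (xi omega : 'I_N -> R) (U : R -> R) m w i : R :=
  (mesh_size m)^-1 * cell_quadrature xi omega m i (fun x => U (w i).[x]).

Definition U_high (N : nat) (xi omega : 'I_N -> R) (U : R -> R) m (dt : R)
    uh Lh i : R :=
  cell_entropy xi omega U m (euler_step dt uh Lh) i.

Definition U_up (N : nat) (xi omega : 'I_N -> R) (U : R -> R)
    (Fhat : R -> R -> R) m (dt : R) uh i : R :=
  cell_entropy xi omega U m uh i
  - dt / mesh_size m * (at_interface m Fhat uh i - at_interface m Fhat uh (i - 1)).

(* Pairs (cell, point of A in it); an interface point is paired with both
   neighbouring cells, which covers the two traces there. *)
Definition cell_points m (A : set R) : set (int * R) :=
  [set ix | cell m ix.1 ix.2 /\ A ix.2].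

End DG.

(* E j z = O(g j) along the filter G, uniformly in z in D j. *)
Definition uniform_bigO {R : realType} {J Z : Type} (G : set_system J)
    (D : J -> set Z) (E : J -> Z -> R) (g : J -> R) : Prop :=
  exists C : R, \forall j \near G, forall z, D j z -> `|E j z| <= C * g j.

(* Main.v *)
(** On a cell write [v = U'(u_h)], [psi = v f(u_h) - F(u_h)], and test the scheme
   with the Taylor polynomial [phi] of [v]; put [delta = phi - v].  Since
   [f(u_h) v_x] is the derivative of [psi (u_h)] and [u_t + f(u)_x = 0],
   [L_h phi - f(u_h) phi_x = L_h v - psi_x - (f(u) delta)_x
     + (L_h - u_t) delta - (f(u_h) - f(u)) delta_x],
   whose last two terms are O(dx^(2k+1)).  Subtracting the exact solution here,
   instead of integrating [f(u_h) delta_x] by parts, requires no smoothness of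
   [f] beyond C^1.  At the interfaces, the compatibility of the entropy flux with
   the numerical flux leaves errors quadratic in the jumps, hence O(dx^(2k+2)).
   The Gauss-Lobatto error for the entropy production [v L_h] is O(dx^(2N-2))
   because derivatives of [v L_h] of every order are bounded uniformly. *)

Require Import Defs.
From HB Require Import structures.
From mathcomp Require Import all_boot all_order all_algebra.
From mathcomp Require Import all_classical all_reals all_analysis.
From mathcomp Require Import ring lra.

Set Implicit Arguments.
Unset Strict Implicit.
Unset Printing Implicit Defensive.

Import Order.TTheory GRing.Theory Num.Theory.
Import numFieldNormedType.Exports.

Local Open Scope classical_set_scope.
Local Open Scope ring_scope.

(** * Calculus on segments *)

Section Calculus.
Context {R : realType}.
Implicit Types (g h : R -> R) (a b c x : R) (p : {poly R}).

Lemma is_derive_continuous g g' : (forall x, is_derive x 1 g (g' x)) ->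
  continuous g.
Proof.
by move=> dg x; apply/differentiable_continuous/derivable1_diffP; case: (dg x).
Qed.

Lemma poly_continuous p : continuous (horner p).
Proof. by apply: (@is_derive_continuous _ (horner p^`())) => x. Qed.

Lemma continuous_bounded g (M : R) : continuous g ->
  exists C : R, forall x, `|x| <= M -> `|g x| <= C.
Proof.
move=> cg; have cK : compact `[- M, M] by exact: segment_compact.
have /compact_bounded [C [_ Cb]] :=
  continuous_compact (continuous_subspaceT cg) cK.
exists (C + 1) => x; rewrite ler_norml => xM.
by apply: (Cb (C + 1)); [rewrite ltrDl ltr01 | exists x => //=; rewrite in_itv].
Qed.

(** The end points are left unordered because the lemma is applied between the two states at an
    interface, whose jump may have either sign. *)
Lemma mvt_bound g g' a b c :
  (forall x, is_derive x 1 g (g' x)) ->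
  (forall x, Num.min a b <= x <= Num.max a b -> `|g' x| <= c) ->
  `|g b - g a| <= c * `|b - a|.
Proof.
move=> dg.
wlog ab : a b / a <= b => [H|].
  have /orP[ab gc|ba gc] := le_total a b; first exact: H.
  rewrite distrC [`|b - a|]distrC; apply: H => // x xab.
  by apply: gc; rewrite minC maxC.
rewrite (min_idPl ab) (max_idPr ab) => gc.
have [x xab ->] := @MVT_segment _ g g' a b ab (fun x _ => dg x)
  (continuous_subspaceT (is_derive_continuous dg)).
by rewrite normrM ler_wpM2r// gc// -in_itv/=.
Qed.

(** Difference quotients with step at most [e] are bounded by [L], and the bound passes to the
    limit. This turns Lipschitz continuity of [fhat] into bounds on its partial derivatives. *)
Lemma lipschitz_derive_bound g x (d L e : R) : 0 < e ->
  is_derive x 1 g d ->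
  (forall y, `|y - x| <= e -> `|g y - g x| <= L * `|y - x|) -> `|d| <= L.
Proof.
move=> e0 [dg <-] Lg.
rewrite -(cvg_lim _ (cvg_norm dg))//.
apply: limr_le; first by apply: is_cvg_norm; exact: dg.
near=> h.
have h0 : h != 0 by near: h; exact: nbhs_dnbhs_neq.
rewrite normrZ normfV /= ler_pdivrMl ?normr_gt0// mulrC.
have /Lg : `|h *: 1 + x - x| <= e.
  rewrite addrK /GRing.scale/= mulr1.
  by near: h; apply: dnbhs0_le.
by rewrite addrK /GRing.scale/= mulr1.
Unshelve. all: end_near. Qed.

Lemma Rintegral_continuous_FTC2 g G a b : a < b -> continuous g ->
  (forall x, is_derive x 1 G (g x)) ->
  \int[lebesgue_measure]_(x in `[a, b]) g x = G b - G a.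
Proof.
move=> ab cg dG; have cG := is_derive_continuous dG.
rewrite /Rintegral (@continuous_FTC2 _ _ G)//.
- exact: continuous_subspaceT.
- split; first by move=> x _; case: (dG x).
  + exact/cvg_at_right_filter/cG.
  + exact/cvg_at_left_filter/cG.
- by move=> x _; rewrite derive1E; case: (dG x).
Qed.

Lemma continuous_integrable_segment g a b : continuous g ->
  (@lebesgue_measure R).-integrable `[a, b] (EFin \o g).
Proof.
move=> cg; apply: continuous_compact_integrable; first exact: segment_compact.
exact: continuous_subspaceT.
Qed.

Lemma RintegralB_segment g h a b : continuous g -> continuous h ->
  \int[lebesgue_measure]_(x in `[a, b]) (g x - h x) =
  \int[lebesgue_measure]_(x in `[a, b]) g x -
  \int[lebesgue_measure]_(x in `[a, b]) h x.
Proof.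
by move=> cg ch; apply: RintegralB => //; exact: continuous_integrable_segment.
Qed.

Lemma normr_Rintegral_segment g a b c : a <= b -> continuous g ->
  (forall x, a <= x <= b -> `|g x| <= c) ->
  `|\int[lebesgue_measure]_(x in `[a, b]) g x| <= c * (b - a).
Proof.
move=> ab cg gc.
have ig := @continuous_integrable_segment _ a b cg.
apply: (le_trans (le_normr_Rintegral _ ig)) => //.
have -> : c * (b - a) = \int[lebesgue_measure]_(x in `[a, b]) (cst c x).
  rewrite Rintegral_cst//= lebesgue_measure_itv/= lte_fin.
  by move: ab; rewrite le_eqVlt => /predU1P[->|->//]; rewrite ltxx subrr.
apply: le_Rintegral => //.
- apply: (@continuous_integrable_segment (fun x => `|g x|)) => x.
  by apply: (@continuous_comp _ _ _ g); [exact: cg | exact: norm_continuous].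
- by apply: continuous_integrable_segment => x; exact: cvg_cst.
Qed.
End Calculus.

(** * Taylor polynomials and families with uniformly bounded derivatives *)

Section Taylor.
Context {R : realType}.
Implicit Types (g h : R -> R) (a b x : R) (p : {poly R}).

(** The index counts terms, so the degree is less than [n]: [taylor k.+1] is an admissible test
    polynomial of degree at most [k]. *)
Definition taylor n g a : {poly R} :=
  \sum_(r < n) (derive1n r g a / r`!%:R) *: ('X - a%:P) ^+ r.

Lemma size_taylor n g a : (size (taylor n g a) <= n)%N.
Proof.
apply: (leq_trans (size_sum _ _ _)); apply/bigmax_leqP => r _.
by apply: (leq_trans (size_scale_leq _ _)); rewrite size_exp_XsubC.
Qed.

Lemma horner_taylor n g a : (taylor n.+1 g a).[a] = g a.
Proof.
rewrite /taylor big_ord_recl hornerD horner_sum big1 => [|r _].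
  by rewrite expr0 fact0 !hornerE divr1.
by rewrite !hornerE subrr expr0n mulr0.
Qed.

Lemma deriv_taylor n g a : (taylor n.+1 g a)^`() = taylor n (derive1 g) a.
Proof.
rewrite /taylor big_ord_recl derivD expr0 alg_polyC derivC add0r raddf_sum.
apply: eq_bigr => r _; rewrite /= derivZ deriv_exp derivXsubC mul1r /=.
rewrite /bump /= add1n add0n -derive1nS derive1Sn -[_ *+ r.+1]scaler_nat scalerA.
congr (_ *: _); rewrite factS natrM invfM -mulrA; congr (_ * _).
by rewrite mulrAC mulVf ?pnatr_eq0// mul1r.
Qed.

(** Induction on the order: the remainder vanishes at [a], and its derivative is the remainder of
    one order less for [derive1 g]. Using the mean value inequality at each stage gives up the
    factor [1/n!], which is harmless in an O-estimate. *)
Lemma taylor_bound n g a b (M : R) :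
  (forall r x, (r < n)%N -> derivable (derive1n r g) x 1) ->
  (forall x, a <= x <= b -> `|derive1n n g x| <= M) ->
  forall x, a <= x <= b -> `|g x - (taylor n g a).[x]| <= M * (b - a) ^+ n.
Proof.
elim: n g => [|n IH] g dg gM x axb.
  by rewrite /taylor big_ord0 horner0 subr0 expr0 mulr1; exact: gM.
have /andP[ax xb] := axb.
pose e y := g y - (taylor n.+1 g a).[y].
have de (y : R) : is_derive y 1 e (derive1 g y - (taylor n (derive1 g) a).[y]).
  rewrite -deriv_taylor; apply: is_deriveB.
  by rewrite derive1E; exact/derivableP/(dg 0).
have := @mvt_bound _ e _ a x (M * (b - a) ^+ n) de.
rewrite /e horner_taylor subrr subr0 (min_idPl ax) (max_idPr ax) => H.
have M0 : 0 <= M by exact: le_trans (gM _ axb).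
apply: (le_trans (H _)) => [y /andP[ay yx]|].
  apply: IH; last by rewrite ay (le_trans yx).
  - by move=> r z rn; rewrite -derive1Sn; exact: dg.
  - by move=> z zab; rewrite -derive1Sn; exact: gM.
rewrite exprSr mulrA; apply: ler_wpM2l.
  by rewrite mulr_ge0// exprn_ge0// subr_ge0 (le_trans ax).
by rewrite ger0_norm ?subr_ge0// lerB.
Qed.

End Taylor.

Section BoundedDerivatives.
Context {R : realType} {I : Type} (D : I -> set R).
Implicit Types (g h : I -> R -> R).

(** Derivability is required on the whole line, bounds only on [D i]. At each order a single bound
    serves all indices [i]; this is the source of the uniformity of the final constants. *)
Fixpoint bounded_upto n g : Prop :=
  (exists M, forall i x, D i x -> `|g i x| <= M) /\
  (if n is n'.+1 then
     (forall i x, derivable (g i) x 1) /\ bounded_upto n' (fun i => derive1 (g i))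
   else True).

Lemma bounded_upto0 n g : bounded_upto n g ->
  exists M, forall i x, D i x -> `|g i x| <= M.
Proof. by case: n => [|n] []. Qed.

Lemma bounded_uptoS n g : bounded_upto n.+1 g -> bounded_upto n g.
Proof.
elim: n g => [|n IH] g [gM]; [by split | case=> dg gn; split => //].
by split => //; exact: IH.
Qed.

Lemma bounded_upto_bound n g : bounded_upto n g ->
  exists M, forall i x, D i x -> `|derive1n n (g i) x| <= M.
Proof.
elim: n g => [|n IH] g; [by case | case=> gM [dg gn]].
by have [M HM] := IH _ gn; exists M => i x Dx; rewrite derive1Sn; exact: HM.
Qed.

Lemma bounded_upto_derivable n g : bounded_upto n g ->
  forall i r x, (r < n)%N -> derivable (derive1n r (g i)) x 1.
Proof.
elim: n g => [//|n IH] g [gM] [dg gn] i [|r] x rn; first exact: dg.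
by rewrite derive1Sn; apply: (IH (fun i => derive1 (g i))).
Qed.

Lemma bounded_uptoD n g h : bounded_upto n g -> bounded_upto n h ->
  bounded_upto n (fun i x => g i x + h i x).
Proof.
elim: n g h => [|n IH] g h [[M gM] gn] [[N hN] hn]; split => //.
- exists (M + N) => i x Dx.
  by apply: (le_trans (ler_normD _ _)); apply: lerD; [exact: gM | exact: hN].
- exists (M + N) => i x Dx.
  by apply: (le_trans (ler_normD _ _)); apply: lerD; [exact: gM | exact: hN].
move: gn hn => [dg gn] [dh hn]; split; first by move=> i x; exact: derivableD.
rewrite (_ : (fun i => _) = fun i x => derive1 (g i) x + derive1 (h i) x).
  exact: IH.
by apply/funext => i; apply/funext => x; rewrite !derive1E deriveD.
Qed.

Lemma bounded_uptoM n g h : bounded_upto n g -> bounded_upto n h ->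
  bounded_upto n (fun i x => g i x * h i x).
Proof.
elim: n g h => [|n IH] g h gn hn; have [M gM] := bounded_upto0 gn;
  have [N hN] := bounded_upto0 hn; (split; [exists (M * N) => i x Dx;
  by rewrite normrM ler_pM ?gM ?hN|]) => //.
(* The product rule pairs an undifferentiated factor with a derivative, so the former is needed at
   the lower order [n] too. *)
have [gn' hn'] := (bounded_uptoS gn, bounded_uptoS hn).
move: gn hn => [_ [dg gn]] [_ [dh hn]].
split; first by move=> i x; exact: derivableM.
rewrite (_ : (fun i => _) =
  fun i x => g i x * derive1 (h i) x + h i x * derive1 (g i) x).
  by apply: bounded_uptoD; apply: IH.
by apply/funext => i; apply/funext => x; rewrite !derive1E deriveM.
Qed.

(** The values of [g] stay in a fixed compact interval, on which [V] is bounded. The derivative is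
    [V'(g) g'], so the induction runs over all outer functions at once and closes with the product
    lemma. *)
Lemma bounded_upto_comp n (V : R -> R) g :
  (forall r x, derivable (derive1n r V) x 1) -> bounded_upto n g ->
  bounded_upto n (fun i x => V (g i x)).
Proof.
elim: n V => [|n IH] V dV gn; have [M gM] := bounded_upto0 gn.
all: have cV : continuous V.
1,3: by move=> x; apply/differentiable_continuous/derivable1_diffP/(dV 0).
all: have [C VC] := continuous_bounded M cV.
all: split; first by exists C => i x Dx; apply/VC/gM.
  by [].
have gn' := bounded_uptoS gn; move: gn => [_ [dg gn]].
have dVg i (x : R) : is_derive x 1 (V \o g i) (derive1 V (g i x) * derive1 (g i) x).
  apply: is_derive1_comp; rewrite derive1E; apply/derivableP => //.
  exact: (dV 0).
split; first by move=> i x; case: (dVg i x).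
rewrite (_ : (fun i => _) = fun i x => derive1 V (g i x) * derive1 (g i) x).
  by apply: bounded_uptoM => //; apply: IH => // r x; rewrite -derive1Sn.
apply/funext => i; apply/funext => x; rewrite derive1E.
by case: (dVg i x).
Qed.

Lemma bounded_upto_poly n (p : I -> {poly R}) (M : R) :
  (forall r i x, D i x -> `|(p i)^`(r).[x]| <= M) ->
  bounded_upto n (fun i => horner (p i)).
Proof.
elim: n p => [|n IH] p pM; (split; [by exists M => i x; exact: (pM 0)|]) => //.
split => //.
rewrite (_ : (fun i => _) = fun i => horner (p i)^`()).
  by apply: IH => r i x; rewrite -derivSn; exact: pM.
by apply/funext => i; apply/funext => x; rewrite derive1E derive_val.
Qed.

End BoundedDerivatives.

(** * Numerical fluxes *)

Section EntropyFlux.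
Context {R : realType}.
Implicit Types (g h : R -> R) (a b c s : R).

Lemma smooth_on_derivable (U : R -> R) : smooth_on setT U ->
  forall r x, derivable (derive1n r U) x 1.
Proof.
case=> O [_ TO OU] r x.
have -> : derive1n r U = iter_derive (nseq r (1 : R)) U.
  elim: r => [//|r IH]; rewrite derive1nS IH.
  by apply/funext => y; rewrite derive1E.
by apply/diff_derivable/OU/TO.
Qed.

Lemma is_derive_derive1n (U : R -> R) r (x : R) : smooth_on setT U ->
  is_derive x 1 (derive1n r U) (derive1n r.+1 U x).
Proof.
move=> sU; rewrite derive1nS derive1E; apply/derivableP.
exact: smooth_on_derivable.
Qed.

Lemma between_norm a b s (M : R) : `|a| <= M -> `|b| <= M ->
  Num.min a b <= s <= Num.max a b -> `|s| <= M.
Proof.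
rewrite !ler_norml => /andP[a1 a2] /andP[b1 b2] /andP[s1 s2].
apply/andP; split; [apply: le_trans s1 | apply: (le_trans s2)].
  by rewrite le_min a1.
by rewrite ge_max a2.
Qed.

Lemma between_dist a b c s : Num.min a b <= c <= Num.max a b ->
  Num.min a b <= s <= Num.max a b -> `|s - c| <= `|b - a|.
Proof.
have [ab|ab] := leP a b => /andP[c1 c2] /andP[s1 s2].
  by rewrite (ger0_norm (x := b - a)) ?subr_ge0// ler_norml; apply/andP; lra.
rewrite (ltr0_norm (x := b - a)) ?subr_lt0// ler_norml; apply/andP; lra.
Qed.

(** Freezing [V] at [c] makes [G - V(c) g] have derivative [(V - V(c)) g'], which is itself of the
    size of [b - a]. The mean value inequality supplies the second power. *)
Lemma compatible_increment g g' G V V' a b c (K L : R) :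
  (forall s, is_derive s 1 g (g' s)) ->
  (forall s, is_derive s 1 G (V s * g' s)) ->
  (forall s, is_derive s 1 V (V' s)) ->
  (forall s, Num.min a b <= s <= Num.max a b -> `|g' s| <= L) ->
  (forall s, Num.min a b <= s <= Num.max a b -> `|V' s| <= K) ->
  Num.min a b <= c <= Num.max a b ->
  `|G b - G a - V c * (g b - g a)| <= K * L * `|b - a| ^+ 2.
Proof.
move=> dg dG dV gL VK cab.
have dH (s : R) : is_derive s 1 (fun r => G r - V c * g r) ((V s - V c) * g' s).
  by rewrite mulrBl; apply: is_deriveB.
have -> : G b - G a - V c * (g b - g a) =
    (G b - V c * g b) - (G a - V c * g a) by ring.
rewrite expr2 mulrA; apply: (mvt_bound dH) => s sab.
rewrite normrM -mulrAC ler_pM ?gL//.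
have /le_trans : `|V s - V c| <= K * `|s - c|.
  apply: (mvt_bound dV) => r /andP[r1 r2]; apply: VK.
  move: cab sab => /andP[c1 c2] /andP[s1 s2].
  rewrite (le_trans _ r1) ?le_min ?c1 ?s1//= (le_trans r2)//.
  by rewrite ge_max c2 s2.
apply; apply: ler_wpM2l; last exact: between_dist.
exact: le_trans (VK c cab).
Qed.

(** The set under the supremum contains [|f'(a)|] and is bounded above by [L], so the supremum is
    not a default value. *)
Lemma LF_speed_bound (f : R -> R) a b (L : R) :
  (forall s, Num.min a b <= s <= Num.max a b -> `|derive1 f s| <= L) ->
  0 <= LF_speed f a b <= L.
Proof.
move=> fL; pose S := [set `|derive1 f w| | w in `[Num.min a b, Num.max a b]].
have aS : S `|derive1 f a|.
  by exists a => //=; rewrite in_itv/= ge_min le_max lexx.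
have ubS : ubound S L by move=> _ [w /= wab <-]; apply: fL; rewrite in_itv in wab.
apply/andP; split; last by apply: ge_sup => //; exists `|derive1 f a|.
by apply: le_trans (ub_le_sup _ aS) => //; exists L.
Qed.

(** The numerical flux is consistent to first order in the jump, the entropy flux compatible with it
    to second order. For a proper pair, one state is held fixed and the other moves away from the
    diagonal. For Lax-Friedrichs, the errors are, up to sign, half sums and half differences of an
    increment along [f] and one along the identity multiplied by the speed, so the speed is never
    differentiated. *)
Lemma flux_estimates (f U F : R -> R) (fhat Fhat : R -> R -> R) (M : R) :
  C1 f -> entropy_pair f U F -> admissible_flux f U F fhat Fhat ->
  exists C, forall a b, `|a| <= M -> `|b| <= M ->
  [/\ `|fhat a b - f a| <= C * `|b - a|,
      `|fhat a b - f b| <= C * `|b - a|,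
      `|Fhat a b - F a - derive1 U a * (fhat a b - f a)|
         <= C * `|b - a| ^+ 2 &
      `|Fhat a b - F b - derive1 U b * (fhat a b - f b)|
         <= C * `|b - a| ^+ 2].
Proof.
move=> [df cf] [sU _ dF] flux.
have dU s : is_derive s 1 (derive1 U) (derive1n 2 U s).
  exact: (is_derive_derive1n 1).
have dU0 (s : R) : is_derive s 1 U (derive1 U s * 1).
  by rewrite mulr1; exact: (is_derive_derive1n 0).
have df1 (s : R) : is_derive s 1 f (derive1 f s).
  by rewrite derive1E; exact/derivableP.
have [K UK] := continuous_bounded M
  (is_derive_continuous (fun s => is_derive_derive1n 2 s sU)).
have minaab a b : Num.min a b <= a <= Num.max a b by rewrite ge_min le_max lexx.
have minbab a b : Num.min a b <= b <= Num.max a b.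
  by rewrite ge_min le_max lexx !orbT.
case: flux => [[mono prop]|[fhatE FhatE]].
(* The derivative at a state in [[-M, M]] is bounded through difference quotients that reach up to
   distance 1 outside this interval. *)
- have [L fL] := flux_lipschitz mono (M + 1).
  exists (L + K * L) => a b aM bM.
  have M1 (s : R) : `|s| <= M -> `|s| <= M + 1 by move=> /le_trans; apply; rewrite lerDl.
  have MD s y : `|s| <= M -> `|y - s| <= 1 -> `|y| <= M + 1.
    move=> sM ys; rewrite -(subrK s y) addrC.
    by rewrite (le_trans (ler_normD _ _))// lerD.
  have dl (s : R) : is_derive s 1 (fhat^~ b) (derive1 (fhat^~ b) s).
    by rewrite derive1E; exact/derivableP/(flux_derivable_l prop).
  have dr (s : R) : is_derive s 1 (fhat a) (derive1 (fhat a) s).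
    by rewrite derive1E; exact/derivableP/(flux_derivable_r prop).
  have bl s : Num.min a b <= s <= Num.max a b -> `|derive1 (fhat^~ b) s| <= L.
    move=> /(between_norm aM bM) sM.
    apply: (lipschitz_derive_bound ltr01 (dl s)) => y ys.
    rewrite (le_trans (fL _ _ _ _ _ _ _ _))// ?subrr ?normr0 ?addr0//; auto.
    exact: MD ys.
  have br s : Num.min a b <= s <= Num.max a b -> `|derive1 (fhat a) s| <= L.
    move=> /(between_norm aM bM) sM.
    apply: (lipschitz_derive_bound ltr01 (dr s)) => y ys.
    rewrite (le_trans (fL _ _ _ _ _ _ _ _))// ?subrr ?normr0 ?add0r//; auto.
    exact: MD ys.
  have UKab s : Num.min a b <= s <= Num.max a b -> `|derive1n 2 U s| <= K.
    by move=> /(between_norm aM bM); exact: UK.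
  have L0 : 0 <= L by exact: le_trans (bl a (minaab a b)).
  have K0 : 0 <= K by exact: le_trans (UK a aM).
  have LC (e : R) : 0 <= e -> L * e <= (L + K * L) * e.
    by move=> e0; rewrite ler_wpM2r// lerDl mulr_ge0.
  have KC (e : R) : 0 <= e -> K * L * e <= (L + K * L) * e.
    by move=> e0; rewrite ler_wpM2r// lerDr.
  rewrite -{1}(flux_consistent mono a) -{1}(flux_consistent mono b).
  split.
  + rewrite (le_trans _ (LC _ _))// (le_trans (fL _ _ _ _ _ _ _ _))//; auto.
    by rewrite subrr normr0 add0r.
  + rewrite (le_trans _ (LC _ _))// (le_trans (fL _ _ _ _ _ _ _ _))//; auto.
    by rewrite subrr normr0 addr0 distrC.
  + rewrite (le_trans _ (KC _ _))// -(entropy_flux_consistent prop a).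
    rewrite -(flux_consistent mono a).
    by apply: (compatible_increment dr (entropy_flux_derive_r prop a) dU).
  + rewrite (le_trans _ (KC _ _))// -(entropy_flux_consistent prop b).
    rewrite -(flux_consistent mono b) [`|b - a|]distrC.
    apply: (compatible_increment dl (fun s => entropy_flux_derive_l prop s b) dU);
      by rewrite minC maxC.
- have [L fL] := continuous_bounded M cf.
  exists (L + K * L) => a b aM bM.
  have fLab s : Num.min a b <= s <= Num.max a b -> `|derive1 f s| <= L.
    by move=> /(between_norm aM bM); exact: fL.
  have UKab s : Num.min a b <= s <= Num.max a b -> `|derive1n 2 U s| <= K.
    by move=> /(between_norm aM bM); exact: UK.
  have /andP[al0 alL] := LF_speed_bound fLab.
  set al := LF_speed f a b in al0 alL.
  have L0 : 0 <= L by exact: le_trans al0 alL.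
  have K0 : 0 <= K by exact: le_trans (UK a aM).
  have LC (e : R) : 0 <= e -> L * e <= (L + K * L) * e.
    by move=> e0; rewrite ler_wpM2r// lerDl mulr_ge0.
  have KC (e : R) : 0 <= e -> K * L * e <= (L + K * L) * e.
    by move=> e0; rewrite ler_wpM2r// lerDr.
  have half (x y e : R) : `|x| <= e -> `|y| <= e -> `|2^-1 * x - 2^-1 * y| <= e.
    by rewrite !ler_norml => /andP[? ?] /andP[? ?]; apply/andP; lra.
  have halfD (x y e : R) : `|x| <= e -> `|y| <= e -> `|2^-1 * x + 2^-1 * y| <= e.
    by rewrite !ler_norml => /andP[? ?] /andP[? ?]; apply/andP; lra.
  have incf : `|f b - f a| <= L * `|b - a| by exact: mvt_bound df1 fLab.
  have inca : `|al * (b - a)| <= L * `|b - a|.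
    by rewrite normrM ler_wpM2r// ger0_norm.
  have incF c : Num.min a b <= c <= Num.max a b ->
      `|F b - F a - derive1 U c * (f b - f a)| <= K * L * `|b - a| ^+ 2.
    exact: (compatible_increment df1 dF dU).
  have incU c : Num.min a b <= c <= Num.max a b ->
      `|al * (U b - U a - derive1 U c * (b - a))| <= K * L * `|b - a| ^+ 2.
    move=> cab; rewrite normrM [K * L]mulrC -mulrA ler_pM//.
      by rewrite ger0_norm.
    (* [U] is the entropy flux that belongs to the linear flux [id], whose derivative is bounded by
       1. *)
    rewrite -[K]mulr1.
    apply: (@compatible_increment id (fun=> 1) U _ _ a b c K 1 _ dU0 dU) => //.
    by move=> s _; rewrite normr1.
  rewrite fhatE FhatE /LF_flux /LF_entropy_flux -/al.
  split.
  + rewrite (le_trans _ (LC _ _))//.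
    by have := half _ _ _ incf inca; congr (`|_| <= _); field.
  + rewrite (le_trans _ (LC _ _))// -normrN.
    by have := halfD _ _ _ incf inca; congr (`|_| <= _); field.
  + rewrite (le_trans _ (KC _ _))//.
    have := half _ _ _ (incF a (minaab a b)) (incU a (minaab a b)).
    by congr (`|_| <= _); field.
  + rewrite (le_trans _ (KC _ _))// -normrN.
    have := halfD _ _ _ (incF b (minbab a b)) (incU b (minbab a b)).
    by congr (`|_| <= _); field.
Qed.

End EntropyFlux.

(** * Entropy production and quadrature on one cell *)

Section Cell.
Context {R : realType}.
Implicit Types (g h w : R -> R) (a b x : R) (p P Q phi : {poly R}).

Lemma continuous_mul g h : continuous g -> continuous h ->
  continuous (fun x => g x * h x).
Proof. by move=> cg ch x; apply: cvgM; [exact: cg | exact: ch]. Qed.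

Lemma continuous_compose g h : continuous g -> continuous h ->
  continuous (fun x => g (h x)).
Proof.
by move=> cg ch x; apply: (@continuous_comp _ _ _ h g); [exact: ch | exact: cg].
Qed.

Lemma entropy_variable_derive (U : R -> R) P x : smooth_on setT U ->
  is_derive x 1 (fun y => derive1 U P.[y]) (derive1n 2 U P.[x] * P^`().[x]).
Proof. by move=> sU; apply: is_derive1_comp; exact: (is_derive_derive1n 1). Qed.

(** [w] stands for the exact solution at a fixed time and [wt] for its time derivative, so the
    hypothesis on [f \o w] is the conservation law. [P], [Q] are the numerical solution and the DG
    operator on the cell, [fl], [fr] the numerical fluxes at its ends; [e] and [d] will be of orders
    [k+1] and [k] in the mesh size. *)
Lemma dg_entropy_defect (f U F w wt : R -> R) P Q phi a b (fl fr e d : R)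
    (v := fun x => derive1 U P.[x])
    (psi := fun x => v x * f P.[x] - F P.[x]) :
  a < b -> C1 f -> entropy_pair f U F -> continuous wt ->
  (forall x, is_derive x 1 (f \o w) (- wt x)) ->
  (forall x, a <= x <= b -> [/\ `|Q.[x] - wt x| <= e,
     `|f P.[x] - f (w x)| <= e, `|phi.[x] - v x| <= e &
     `|phi^`().[x] - derive1n 2 U P.[x] * P^`().[x]| <= d]) ->
  `|fr - f (w b)| <= e -> `|fl - f (w a)| <= e ->
  \int[lebesgue_measure]_(x in `[a, b]) (Q.[x] * phi.[x]) =
    \int[lebesgue_measure]_(x in `[a, b]) (f P.[x] * phi^`().[x])
    - fr * phi.[b] + fl * phi.[a] ->
  `|\int[lebesgue_measure]_(x in `[a, b]) (v x * Q.[x])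
    + (fr * v b - psi b) - (fl * v a - psi a)|
  <= (e * e + e * d) * (b - a) + (e * e + e * e).
Proof.
move=> ab [df _] [sU _ dF] cwt dfw near_w frw flw DG.
have axb : a <= a <= b /\ a <= b <= b by rewrite !lexx ltW.
have df1 (s : R) : is_derive s 1 f (derive1 f s).
  by rewrite derive1E; exact/derivableP.
have dv x := entropy_variable_derive P x sU.
pose v' x := derive1n 2 U P.[x] * P^`().[x].
have cf := is_derive_continuous df1.
have cfw : continuous (f \o w) by exact: is_derive_continuous dfw.
have cv : continuous v by exact: is_derive_continuous dv.
have cv' : continuous v'.
  apply: continuous_mul; last exact: poly_continuous.
  apply: (continuous_compose (g := derive1n 2 U)); last exact: poly_continuous.
  exact: is_derive_continuous (fun s => is_derive_derive1n 2 s sU).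
have cfP : continuous (fun x => f P.[x]).
  by apply: (continuous_compose cf); exact: poly_continuous.
(* [H] collects the exact derivatives: once [H'] is subtracted, the integrand consists only of
   products of two small factors, and [H] itself contributes boundary values. *)
pose H x := psi x + f (w x) * (phi.[x] - v x).
pose H' x := f P.[x] * v' x
  + (f (w x) * (phi^`().[x] - v' x) + (phi.[x] - v x) * - wt x).
have dpsi x : is_derive x 1 psi (f P.[x] * v' x).
  have dFP : is_derive x 1 (F \o horner P)
      (derive1 U P.[x] * derive1 f P.[x] * P^`().[x]).
    by apply: is_derive1_comp; exact: dF.
  have dfP : is_derive x 1 (f \o horner P) (derive1 f P.[x] * P^`().[x]).
    by apply: is_derive1_comp.
  apply: is_derive_eq (is_deriveB (is_deriveM (dv x) dfP) dFP) _.
  by rewrite /GRing.scale/= /v /v' [derive1n 2 U]derive1nS derive1n1; ring.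
have dH x : is_derive x 1 H (H' x).
  by apply: is_deriveD => //; apply: (is_deriveM (dfw x)); apply: is_deriveB.
have cH' : continuous H'.
  have cphi' : continuous (fun x => phi^`().[x] - v' x).
    by move=> x; apply: cvgB; [exact: poly_continuous | exact: cv'].
  have cphi : continuous (fun x => phi.[x] - v x).
    by move=> x; apply: cvgB; [exact: poly_continuous | exact: cv].
  have cNwt : continuous (fun x => - wt x) by move=> x; apply: cvgN; exact: cwt.
  move=> x; apply: cvgD; first exact: (continuous_mul cfP cv').
  apply: cvgD; first exact: (continuous_mul cfw cphi').
  exact: (continuous_mul cphi cNwt).
have cS1 : continuous (fun x => v x * Q.[x]).
  by apply: continuous_mul => //; exact: poly_continuous.
have cS2 : continuous (fun x => Q.[x] * phi.[x]).
  by apply: continuous_mul; exact: poly_continuous.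
have cS3 : continuous (fun x => f P.[x] * phi^`().[x]).
  by apply: continuous_mul => //; exact: poly_continuous.
have cS23 : continuous (fun x => Q.[x] * phi.[x] - f P.[x] * phi^`().[x]).
  by move=> x; apply: cvgB; [exact: cS2 | exact: cS3].
have cS : continuous
    (fun x => v x * Q.[x] - (Q.[x] * phi.[x] - f P.[x] * phi^`().[x])).
  by move=> x; apply: cvgB; [exact: cS1 | exact: cS23].
pose S x := v x * Q.[x] - (Q.[x] * phi.[x] - f P.[x] * phi^`().[x]) - H' x.
have intS : \int[lebesgue_measure]_(x in `[a, b]) S x =
    \int[lebesgue_measure]_(x in `[a, b]) (v x * Q.[x])
    + (fr * phi.[b] - fl * phi.[a]) - (H b - H a).
  rewrite RintegralB_segment// RintegralB_segment// RintegralB_segment//.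
  by rewrite (Rintegral_continuous_FTC2 ab cH' dH) DG; ring.
have Sle : `|\int[lebesgue_measure]_(x in `[a, b]) S x|
    <= (e * e + e * d) * (b - a).
  apply: normr_Rintegral_segment; first exact: ltW.
    by move=> x; apply: cvgB; [exact: cS | exact: cH'].
  move=> x /near_w[Qe fe phie phid].
  have -> : S x = (f P.[x] - f (w x)) * (phi^`().[x] - v' x)
      - (Q.[x] - wt x) * (phi.[x] - v x).
    by rewrite /S /H'; ring.
  rewrite (le_trans (ler_normB _ _))// addrC.
  by rewrite !normrM lerD// ler_pM.
have [[_ _ phia _] [_ _ phib _]] := (near_w a axb.1, near_w b axb.2).
(* The boundary values of [H] combine with the DG fluxes. Each end point keeps the entropy term in
   [v] and [psi], plus a flux error times [phi - v], again a product of two small factors. *)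
rewrite (_ : _ - _ = \int[lebesgue_measure]_(x in `[a, b]) S x
    - ((fr - f (w b)) * (phi.[b] - v b) - (fl - f (w a)) * (phi.[a] - v a))).
  rewrite (le_trans (ler_normB _ _))// lerD// (le_trans (ler_normB _ _))//.
  by rewrite !normrM lerD// ler_pM.
by rewrite intS /H; ring.
Qed.

Lemma poly_antiderivative p : exists P, P^`() = p.
Proof.
(* The entry for [i = 0] is a division by zero, hence 0; differentiation discards it. *)
exists (\poly_(i < (size p).+1) (p`_i.-1 / i%:R)).
apply/polyP => i; rewrite coef_deriv coef_poly ltnS; case: ltnP => [ip|pi] /=.
  by rewrite -[LHS]mulr_natr divfK ?pnatr_eq0.
by rewrite mul0rn nth_default.
Qed.

(** Both integrals are evaluated from polynomial antiderivatives, related by the same affine map.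
    This carries the exactness of the rule from [[0, 1]] to a cell. *)
Lemma Rintegral_poly_affine p a (h : R) : 0 < h ->
  \int[lebesgue_measure]_(x in `[a, a + h]) p.[x] =
  h * \int[lebesgue_measure]_(y in `[0, 1]) (p \Po (h *: 'X + a%:P)).[y].
Proof.
move=> h0; have [P PE] := poly_antiderivative p.
have dP (x : R) : is_derive x 1 (horner P) p.[x] by rewrite -PE; exact: is_derive_poly.
have ah : a < a + h by rewrite ltrDl.
rewrite (Rintegral_continuous_FTC2 ah (@poly_continuous _ p) dP).
have dQ (x : R) : is_derive x 1 (horner (h^-1 *: (P \Po (h *: 'X + a%:P))))
    (p \Po (h *: 'X + a%:P)).[x].
  suff <- : (h^-1 *: (P \Po (h *: 'X + a%:P)))^`() = p \Po (h *: 'X + a%:P).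
    exact: is_derive_poly.
  rewrite derivZ deriv_comp PE derivD derivC derivZ derivX addr0.
  by rewrite -scalerAr mulr1 scalerA mulVf ?scale1r ?gt_eqF.
rewrite (Rintegral_continuous_FTC2 ltr01 (@poly_continuous _ _) dQ).
rewrite !hornerZ !horner_comp !hornerE -mulrBr mulrA divff ?gt_eqF// mul1r.
by rewrite [h + a]addrC.
Qed.

Lemma gauss_lobatto_node N (xi omega : 'I_N -> R) (q : 'I_N) :
  gauss_lobatto xi omega -> 0 <= xi q <= 1.
Proof.
case: N xi omega q => [|N] xi omega q; first by case: q.
case=> mono xi0 xi1 _; apply/andP; split.
  have [q0|q0] := posnP q; first by rewrite xi0.
  by rewrite -(xi0 ord0)// ltW// mono.
have [qN|qN] := eqVneq (q : nat) N; first by rewrite xi1.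
by rewrite -(xi1 ord_max)// ltW// mono//= ltn_neqAle qN -ltnS ltn_ord.
Qed.

(** The rule is exact on the Taylor polynomial with [2 * N - 2] terms, so both the sum and the
    integral see only the remainder. The sum accounts for the absolute weights in the constant, the
    integral for the [1]. *)
Lemma gauss_lobatto_error N (xi omega : 'I_N -> R) g a (h M : R) :
  (0 < 2 * N - 2)%N -> gauss_lobatto xi omega -> 0 < h ->
  (forall r x, (r < 2 * N - 2)%N -> derivable (derive1n r g) x 1) ->
  (forall x, a <= x <= a + h -> `|derive1n (2 * N - 2) g x| <= M) ->
  `|h * \sum_(q < N) omega q * g (a + h * xi q)
    - \int[lebesgue_measure]_(x in `[a, a + h]) g x|
  <= (\sum_(q < N) `|omega q| + 1) * M * h ^+ (2 * N - 2) * h.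
Proof.
set n := (2 * N - 2)%N => n0 GL h0 dg gM.
pose p := taylor n g a.
have pM x : a <= x <= a + h -> `|g x - p.[x]| <= M * h ^+ n.
  by move=> /(taylor_bound dg gM); rewrite [a + h]addrC addrK.
have cg : continuous g.
  move=> x; apply/differentiable_continuous/derivable1_diffP.
  exact: (dg 0).
have exact_p : h * \sum_(q < N) omega q * p.[a + h * xi q] =
    \int[lebesgue_measure]_(x in `[a, a + h]) p.[x].
  rewrite Rintegral_poly_affine//; congr (_ * _).
  have [_ _ _ <-] := GL.
    by apply: eq_bigr => q _; rewrite horner_comp !hornerE [a + _]addrC.
  (* Composition with an affine polynomial does not raise the degree. For the zero polynomial the
     general size bound is 1, which [0 < n] absorbs. *)
  rewrite (leq_trans (size_comp_poly_leq _ _))// -/n.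
  have sz2 : (size (h *: 'X + a%:P : {poly R})%R <= 2)%N.
    rewrite (leq_trans (size_polyD _ _))// geq_max.
    rewrite (leq_trans (size_scale_leq _ _)) ?size_polyX//.
    by rewrite (leq_trans (size_polyC_leq1 _)).
  have : ((size p).-1 * (size (h *: 'X + a%:P : {poly R})%R).-1 <= (size p).-1 * 1)%N.
    by rewrite leq_mul2l; case: (size _) sz2 => [|[|[]]]; rewrite ?orbT.
  rewrite muln1 -ltnS => /leq_trans; apply.
  have : (size p <= n)%N by exact: size_taylor.
  by case: (size p).
rewrite (_ : _ - _ = h * \sum_(q < N) omega q * (g (a + h * xi q) - p.[a + h * xi q])
   - \int[lebesgue_measure]_(x in `[a, a + h]) (g x - p.[x])); last first.
  rewrite RintegralB_segment//; last exact: poly_continuous.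
  under [X in _ = _ * X - _]eq_bigr do rewrite mulrBr.
  by rewrite sumrB mulrBr exact_p; ring.
rewrite (le_trans (ler_normB _ _))//.
have -> : (\sum_(q < N) `|omega q| + 1) * M * h ^+ n * h =
    h * \sum_(q < N) (`|omega q| * (M * h ^+ n)) + M * h ^+ n * (a + h - a).
  by rewrite -mulr_suml; ring.
rewrite lerD//.
- rewrite normrM gtr0_norm// ler_wpM2l ?(ltW h0)//.
  rewrite (le_trans (ler_norm_sum _ _ _))// ler_sum// => q _.
  rewrite normrM ler_wpM2l// pM// lerDl lerD2l mulr_ge0 ?(ltW h0)//=.
    by rewrite ler_piMr ?(ltW h0)//; have /andP[] := gauss_lobatto_node q GL.
  by have /andP[] := gauss_lobatto_node q GL.
- apply: normr_Rintegral_segment => //; first by rewrite lerDl ltW.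
  by move=> x; apply: cvgB; [exact: cg | exact: poly_continuous].
Qed.

End Cell.

(** * The exact solution *)

Section ExactSolution.
Context {R : realType}.
Implicit Types (u : R * R -> R) (x t T : R).

Lemma slice_is_derive u x t : differentiable u (x, t) ->
  is_derive x 1 (fun y => u (y, t)) ('D_((1, 0) : R * R) u (x, t)).
Proof.
move=> /(@diff_derivable _ _ _ _ _ ((1, 0) : R * R)) du.
have E : (fun h : R => h^-1 *: (((fun y => u (y, t)) \o shift x) (h *: 1)
      - u (x, t))) =
    (fun h : R => h^-1 *: ((u \o shift (x, t)) (h *: ((1, 0) : R * R)) - u (x, t))).
  apply/funext => h; congr (_ *: (u _ - _)).
  rewrite /shift/=; congr (_, _); rewrite -[LHS]add0r; congr (_ + _).
  exact/esym/mulr0.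
by split; [rewrite /derivable E | rewrite /derive E].
Qed.

Lemma slice_continuous u t : (forall x, differentiable u (x, t)) ->
  continuous (fun x => u (x, t)).
Proof.
move=> du x; apply: (@continuous_comp _ _ _ (fun y : R => (y, t)) u).
  by apply: (@cvg_pair _ _ _ _ (nbhs x) (nbhs t)); [exact: cvg_id | exact: cvg_cst].
exact: differentiable_continuous.
Qed.

Lemma vertical_continuous u x t : differentiable u (x, t) ->
  {for t, continuous (fun s => u (x, s))}.
Proof.
move=> du; apply: (@continuous_comp _ _ _ (fun s : R => (x, s)) u).
  by apply: (@cvg_pair _ _ _ _ (nbhs x) (nbhs t)); [exact: cvg_cst | exact: cvg_id].
exact: differentiable_continuous.
Qed.

Lemma smooth_on_slab u T x t vs : smooth_on (slab setT T) u ->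
  0 <= t <= T -> differentiable (iter_derive vs u) (x, t).
Proof.
by case=> O [_ SO du] tT; apply/du/SO; split => //=; rewrite in_itv.
Qed.

(** The equation only gives the value of [derive1]; that the derivative exists comes from the chain
    rule, and the equation then identifies it. *)
Lemma flux_derivative (f : R -> R) T u x t : C1 f -> 0 < T ->
  exact_solution f T u -> 0 <= t <= T ->
  is_derive x 1 (f \o (fun y => u (y, t))) (- dt_once u (x, t)).
Proof.
move=> [df cf] T0 [su pde] tT.
have chain (s y : R) : 0 <= s <= T -> is_derive y 1 (f \o (fun y => u (y, s)))
    (derive1 f (u (y, s)) * 'D_((1, 0) : R * R) u (y, s)).
  move=> sT; apply: is_derive1_comp.
    by rewrite derive1E; exact/derivableP.
  by apply: slice_is_derive; exact: (smooth_on_slab y [::] su sT).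
pose h s := dt_once u (x, s)
  + derive1 f (u (x, s)) * 'D_((1, 0) : R * R) u (x, s).
have h0 s : 0 < s -> s <= T -> h s = 0.
  move=> s0 sT; have s0T : 0 <= s <= T by rewrite (ltW s0).
  by rewrite /h; have [_ <-] := chain s x s0T; rewrite -derive1E; exact: pde.
(* The equation holds for t > 0 only; it extends to t = 0 by continuity. *)
suff ht : h t = 0.
  apply: (is_derive_eq (chain t x tT)).
  by move: ht => /eqP; rewrite addr_eq0 => /eqP ->; rewrite opprK.
move: tT => /andP[]; rewrite le_eqVlt => /predU1P[<- _|]; last exact: h0.
have T00 : 0 <= (0 : R) <= T by rewrite lexx ltW.
have hc : h s @[s --> 0^'+] --> h 0.
  apply: cvg_at_right_filter; apply: cvgD.
    exact: (vertical_continuous (smooth_on_slab x [:: ((0, 1) : R * R)] su T00)).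
  apply: cvgM.
    apply: (@continuous_comp _ _ _ (fun s => u (x, s)) (derive1 f)).
      exact: (vertical_continuous (smooth_on_slab x [::] su T00)).
    exact: cf.
  exact: (vertical_continuous (smooth_on_slab x [:: ((1, 0) : R * R)] su T00)).
have hz : h s @[s --> 0^'+] --> (0 : R).
  apply: cvg_near_cst; near=> s; apply: h0; near: s.
    exact: nbhs_right_gt.
  exact: nbhs_right_le.
exact: (cvg_unique _ hc hz).
Unshelve. all: end_near. Qed.

End ExactSolution.

(** * Uniform O-estimates and the entropy balance of one cell *)

Section Asymptotics.
Context {R : realType} {J Z : Type} (G : set_system J) {FG : Filter G}.

(** Finitely many eventual statements along a filter hold together. Constants are added in absolute
    value, so their sum dominates each of them. *)
Lemma uniform_bigO_family (n : nat) (D : J -> set Z) (E : nat -> J -> Z -> R)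
    (g : nat -> J -> R) :
  (forall q j, 0 <= g q j) ->
  (forall q, (q <= n)%N -> uniform_bigO G D (E q) (g q)) ->
  exists C : R, 0 <= C /\ \forall j \near G,
    forall q z, (q <= n)%N -> D j z -> `|E q j z| <= C * g q j.
Proof.
move=> g0; elim: n => [|n IH] En.
  have [C CE] := En 0%N isT; exists `|C|; split => //.
  apply: filterS CE => j CE [|//] z _ /CE/le_trans; apply.
  by rewrite ler_wpM2r ?ler_norm.
have [C [C0 CE]] := IH (fun q qn => En q (leqW qn)).
have [C' CE'] := En n.+1 (leqnn _); exists (C + `|C'|); split.
  by rewrite addr_ge0.
apply: filterS2 CE CE' => j CE CE' q z; rewrite leq_eqVlt => /predU1P[->|].
  move=> /CE'/le_trans; apply; rewrite ler_wpM2r// (le_trans (ler_norm _))//.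
  by rewrite lerDr.
by rewrite ltnS => qn Djz; rewrite (le_trans (CE q z qn Djz))// ler_wpM2r// lerDl.
Qed.

End Asymptotics.

(** The defect estimate is used with errors [E * h ^+ k.+1] and [E * h ^+ k], where [E] adds up the
    constants of all the approximations involved. Both traces at an interface approximate the same
    value of [w], so jumps are at most [2 * K * h ^+ k.+1] and the quadratic entropy flux errors
    have order [2k+2]. *)
Lemma dg_entropy_production (R : realType) (f U F w wt : R -> R)
    (fhat Fhat : R -> R -> R) (P Q phi : {poly R}) (a h ul ur M C L K V : R)
    (k : nat) (v := fun x => derive1 U P.[x]) (E := K + L * K + V + 2 * C * K) :
  0 < h <= 1 -> C1 f -> entropy_pair f U F -> continuous wt ->
  (forall x : R, is_derive x 1 (f \o w) (- wt x)) ->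
  0 <= C -> 0 <= L -> 0 <= K -> 0 <= V ->
  (forall r s, `|r| <= M -> `|s| <= M ->
    [/\ `|fhat r s - f r| <= C * `|s - r|, `|fhat r s - f s| <= C * `|s - r|,
        `|Fhat r s - F r - derive1 U r * (fhat r s - f r)| <= C * `|s - r| ^+ 2 &
        `|Fhat r s - F s - derive1 U s * (fhat r s - f s)|
          <= C * `|s - r| ^+ 2]) ->
  (forall r s, `|r| <= M -> `|s| <= M -> `|f s - f r| <= L * `|s - r|) ->
  `|ul| <= M -> `|ur| <= M ->
  `|ul - w a| <= K * h ^+ k.+1 -> `|ur - w (a + h)| <= K * h ^+ k.+1 ->
  (forall x, a <= x <= a + h -> [/\ `|w x| <= M, `|P.[x]| <= M,
     `|P.[x] - w x| <= K * h ^+ k.+1 & `|Q.[x] - wt x| <= K * h ^+ k.+1]) ->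
  (forall x, a <= x <= a + h -> `|phi.[x] - v x| <= V * h ^+ k.+1 /\
     `|phi^`().[x] - derive1n 2 U P.[x] * P^`().[x]| <= V * h ^+ k) ->
  \int[lebesgue_measure]_(x in `[a, a + h]) (Q.[x] * phi.[x]) =
    \int[lebesgue_measure]_(x in `[a, a + h]) (f P.[x] * phi^`().[x])
    - fhat P.[a + h] ur * phi.[a + h] + fhat ul P.[a] * phi.[a] ->
  `|\int[lebesgue_measure]_(x in `[a, a + h]) (v x * Q.[x])
    + Fhat P.[a + h] ur - Fhat ul P.[a]|
  <= (4 * E ^+ 2 + 8 * C * K ^+ 2) * h ^+ (2 * k + 2).
Proof.
move=> /andP[h0 h1] f1 UF cwt dfw C0 L0 K0 V0 fluxM lipM ulM urM ulw urw near_w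
  near_v DG.
have E0 : 0 <= E by rewrite !addr_ge0 ?mulr_ge0.
set b := a + h in urw near_w near_v DG *.
have ab : a < b by rewrite ltrDl.
have aab : a <= a <= b by rewrite lexx ltW.
have bab : a <= b <= b by rewrite lexx ltW.
have [waM PaM Pwa _] := near_w a aab; have [wbM PbM Pwb _] := near_w b bab.
set X := h ^+ k.+1 in ulw urw near_w near_v Pwa Pwb.
have X0 : 0 <= X by rewrite exprn_ge0 ?ltW.
have Y0 : 0 <= h ^+ k by rewrite exprn_ge0 ?ltW.
have jump (p q r : R) : `|p - r| <= K * X -> `|q - r| <= K * X ->
    `|p - q| <= 2 * K * X.
  by rewrite !ler_norml => /andP[? ?] /andP[? ?]; apply/andP; lra.
have jb : `|ur - P.[b]| <= 2 * K * X by exact: jump urw Pwb.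
have ja : `|P.[a] - ul| <= 2 * K * X by exact: jump Pwa ulw.
have [f1b _ F1b _] := fluxM _ _ PbM urM.
have [_ f2a _ F2a] := fluxM _ _ ulM PaM.
have lip x : a <= x <= b -> `|f P.[x] - f (w x)| <= L * (K * X).
  move=> /near_w[wM PM Pw _]; rewrite (le_trans (lipM _ _ wM PM))//.
  exact: ler_wpM2l.
have EX (c : R) : c <= K + L * K + V + 2 * C * K -> c * X <= E * X.
  by move=> cE; rewrite ler_wpM2r.
have LK0 : 0 <= L * K by exact: mulr_ge0.
have CK0 : 0 <= 2 * C * K by rewrite !mulr_ge0.
have fsum (p q r : R) : `|p - q| <= C * (2 * K * X) ->
    `|q - r| <= L * (K * X) -> `|p - r| <= E * X.
  move=> pq qr; rewrite (le_trans (ler_distD q _ _))//.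
  rewrite (le_trans (lerD pq qr))//.
  rewrite (_ : _ + _ = (2 * C * K + L * K) * X); last by ring.
  by apply: EX; lra.
have frw : `|fhat P.[b] ur - f (w b)| <= E * X.
  apply: fsum (lip b bab); apply: (le_trans f1b); exact: ler_wpM2l.
have flw : `|fhat ul P.[a] - f (w a)| <= E * X.
  apply: fsum (lip a aab); apply: (le_trans f2a); exact: ler_wpM2l.
have near_all x : a <= x <= b -> [/\ `|Q.[x] - wt x| <= E * X,
     `|f P.[x] - f (w x)| <= E * X, `|phi.[x] - v x| <= E * X &
     `|phi^`().[x] - derive1n 2 U P.[x] * P^`().[x]| <= E * h ^+ k].
  move=> xab; have [_ _ _ Qx] := near_w x xab; have [vx v'x] := near_v x xab.
  split.
  - by apply: (le_trans Qx); apply: EX; lra.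
  - by apply: (le_trans (lip x xab)); rewrite mulrA; apply: EX; lra.
  - by apply: (le_trans vx); apply: EX; lra.
  - by apply: (le_trans v'x); rewrite ler_wpM2r//; rewrite /E; lra.
have D := dg_entropy_defect ab f1 UF cwt dfw near_all frw flw DG.
have sq (j : R) : `|j| <= 2 * K * X -> C * `|j| ^+ 2 <= 4 * C * K ^+ 2 * X ^+ 2.
  move=> jX; rewrite (_ : _ * X ^+ 2 = C * (2 * K * X) ^+ 2); last by ring.
  by rewrite ler_wpM2l// lerXn2r// nnegrE !mulr_ge0.
rewrite (_ : _ - _ =
    (\int[lebesgue_measure]_(x in `[a, b]) (v x * Q.[x])
     + (fhat P.[b] ur * v b - (v b * f P.[b] - F P.[b]))
     - (fhat ul P.[a] * v a - (v a * f P.[a] - F P.[a])))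
    + (Fhat P.[b] ur - F P.[b] - v b * (fhat P.[b] ur - f P.[b])
       - (Fhat ul P.[a] - F P.[a] - v a * (fhat ul P.[a] - f P.[a]))));
  last by ring.
rewrite (le_trans (ler_normD _ _))//.
rewrite (le_trans (lerD D (ler_normB _ _)))//.
rewrite (le_trans (lerD (lexx _) (lerD (le_trans F1b (sq _ jb))
  (le_trans F2a (sq _ ja)))))//.
have -> : h ^+ (2 * k + 2) = X ^+ 2.
  by rewrite -exprM -[k.+1]addn1 mulnDl mul1n [(2 * k)%N]mulnC.
have XY : X = h ^+ k * h by rewrite -exprSr.
have -> : b - a = h by rewrite /b addrC addKr.
(* The order lost in the derivative of [phi] is regained from the cell length: [X * h ^+ k * h] is
   [X ^+ 2]. *)
have -> : (E * X * (E * X) + E * X * (E * h ^+ k)) * h =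
    E ^+ 2 * X ^+ 2 * h + E ^+ 2 * X ^+ 2 by rewrite XY; ring.
have : E ^+ 2 * X ^+ 2 * h <= E ^+ 2 * X ^+ 2.
  by rewrite ler_piMr// mulr_ge0// exprn_ge0.
by move=> ?; lra.
Qed.

(** * Constants uniform in the discretization, and assembly of the estimate *)

Lemma bounded_derivatives_family (R : realType) (A : set R) (T : R)
    (u : R * R -> R) (vs : nat -> seq (R * R)) (n : nat) :
  bounded_derivatives A T u ->
  exists B : R, 0 <= B /\ forall q z, (q <= n)%N -> slab A T z ->
    `|iter_derive (vs q) u z| <= B.
Proof.
(* A uniform bound is an O(1) estimate over a one-point index set. *)
move=> bu; have [|q _|B [B0 bB]] := @uniform_bigO_family R unit _
  (globally [set: unit]) _ n (fun=> slab A T)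
  (fun q _ => iter_derive (vs q) u) (fun _ _ => 1).
- by move=> *; exact: ler01.
- have [C bC] := bu (vs q); exists C => _ _ z Az; rewrite mulr1; exact: bC.
- exists B; split => // q z qn Az; have := bB tt I q z qn Az.
  by rewrite mulr1.
Qed.

(** Derivatives of order beyond [k] vanish. Hence the assumptions, which stop at order [k], control
    every derivative, as the quadrature error of order [2 * N - 2] demands. *)
Lemma derivn_bound (R : realType) (p : {poly R}) (k : nat) (x B : R) :
  (size p <= k.+1)%N -> (forall q, (q <= k)%N -> `|(p^`(q)).[x]| <= B) ->
  forall q, `|(p^`(q)).[x]| <= B.
Proof.
move=> sp pB q; have [/pB//|kq] := leqP q k.
rewrite derivn_poly0 ?(leq_trans sp)// horner0 normr0.
exact: le_trans (pB 0%N (leq0n k)).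
Qed.

Theorem theorem3p11 (R : realType)
  (f U F : R -> R) (fhat Fhat : R -> R -> R) (T : R) (u : R * R -> R)
  (f_C1 : C1 f) (T_gt0 : 0 < T)
  (u_exact : exact_solution f T u)
  (UF : entropy_pair f U F)
  (flux : admissible_flux f U F fhat Fhat)
  (k N : nat) (xi omega : 'I_N -> R)
  (kN : (k + 3 <= 2 * N)%N)
  (GL : gauss_lobatto xi omega)
  (* family of discretizations: mesh, time step, time level n, u_h^n, L_h(u_h^n) *)
  (J : Type) (G : set_system J) (FG : Filter G)
  (m : J -> mesh R) (dt : J -> R) (n : J -> nat)
  (uh Lh : J -> int -> {poly R})
  (dx := fun j => mesh_size (m j)) (t := fun j => (n j)%:R * dt j)
  (dx_gt0 : forall j, 0 < dx j) (dt_gt0 : forall j, 0 < dt j)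
  (dx_to0 : dx j @[j --> G] --> (0 : R))
  (dt_to0 : dt j @[j --> G] --> (0 : R))
  (t_le : forall j, t j <= T)
  (uh_Vh : forall j, Vh k (uh j))
  (Lh_DG : forall j, is_DG_operator f fhat (m j) k (uh j) (Lh j))
  (* region on which the O-estimates are uniform, e.g. any compact set *)
  (A : set R) (u_bounded : bounded_derivatives A T u)
  (assumption1 : forall q : nat, (q <= k)%N ->
    uniform_bigO G (fun j => cell_points (m j) A)
      (fun j ix => ((uh j ix.1)^`(q)).[ix.2] - dx_iter q u (ix.2, t j))
      (fun j => dx j ^+ (k + 1 - q)))
  (assumption2 : forall q : nat, (q <= k)%N ->
    uniform_bigO G (fun j => cell_points (m j) A)
      (fun j ix => ((Lh j ix.1)^`(q)).[ix.2] - dx_iter q (dt_once u) (ix.2, t j))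
      (fun j => dx j ^+ (k + 1 - q)))
  (assumption3 :
    uniform_bigO G (fun j => cell_points (m j) A)
      (fun j ix => U (euler_step (dt j) (uh j) (Lh j) ix.1).[ix.2]
         - U (uh j ix.1).[ix.2]
         - dt j * (derive1 U (uh j ix.1).[ix.2] * (Lh j ix.1).[ix.2]))
      (fun j => dt j ^+ 2)) :
  uniform_bigO G (fun j => [set i : int | cell (m j) i `<=` A])
    (fun j i => U_high xi omega U (m j) (dt j) (uh j) (Lh j) i
       - U_up xi omega U Fhat (m j) (dt j) (uh j) i)
    (fun j => dx j ^+ (2 * k + 1) * dt j + dx j ^+ (2 * N - 2) * dt j
       + dt j ^+ 2).
Proof.
have [sU _ dF] := UF; have [su _] := u_exact; have [df cf] := f_C1.
have df1 (s : R) : is_derive s 1 f (derive1 f s).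
  by rewrite derive1E; exact/derivableP.
have pow0 (q : nat) j : 0 <= dx j ^+ (k + 1 - q) by rewrite exprn_ge0 ?ltW.
have [K1 [K10 near1]] := uniform_bigO_family
  (g := fun q j => dx j ^+ (k + 1 - q)) pow0 assumption1.
have [K2 [K20 near2]] := uniform_bigO_family
  (g := fun q j => dx j ^+ (k + 1 - q)) pow0 assumption2.
have [K3 near3] := assumption3.
have near_dx : \forall j \near G, dx j <= 1.
  have := dx_to0; move=> /cvgrPdist_le/(_ 1 ltr01).
  by apply: filterS => j; rewrite sub0r normrN; exact: le_trans (ler_norm _).
have [B1 [B10 uB]] := bounded_derivatives_family
  (fun q => nseq q ((1, 0) : R * R)) k u_bounded.
have [B2 [B20 utB]] := bounded_derivatives_family
  (fun q => nseq q ((1, 0) : R * R) ++ [:: ((0, 1) : R * R)]) k u_bounded.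
pose good j := [/\ dx j <= 1,
  forall q ix, (q <= k)%N -> cell_points (m j) A ix ->
    `|((uh j ix.1)^`(q)).[ix.2] - dx_iter q u (ix.2, t j)|
      <= K1 * dx j ^+ (k + 1 - q),
  forall q ix, (q <= k)%N -> cell_points (m j) A ix ->
    `|((Lh j ix.1)^`(q)).[ix.2] - dx_iter q (dt_once u) (ix.2, t j)|
      <= K2 * dx j ^+ (k + 1 - q) &
  forall ix, cell_points (m j) A ix ->
    `|U (euler_step (dt j) (uh j) (Lh j) ix.1).[ix.2] - U (uh j ix.1).[ix.2]
      - dt j * (derive1 U (uh j ix.1).[ix.2] * (Lh j ix.1).[ix.2])|
      <= K3 * dt j ^+ 2].
have near_good : \forall j \near G, good j.
  by apply: filterS2 (filterI near_dx near1) (filterI near2 near3) => j [? ?] [? ?]; split.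
have tT j : 0 <= t j <= T by rewrite t_le mulr_ge0// ltW.
have slabA j x : A x -> slab A T (x, t j) by move=> Ax; split => //=; rewrite in_itv/= tT.
have pow1 j q : good j -> dx j ^+ q <= 1.
  by case=> dx1 _ _ _; rewrite exprn_ile1 ?(ltW (dx_gt0 j)).
pose M1 := B1 + K1; pose M2 := B2 + K2.
have uhM j i x : good j -> cell_points (m j) A (i, x) ->
    forall q, `|((uh j i)^`(q)).[x]| <= M1.
  move=> gj ixA; have [_ Ax] := ixA; apply: derivn_bound (uh_Vh j i) _ => q qk.
  have [_ /(_ q (i, x) qk ixA)/= uq _ _] := gj.
  rewrite -(subrK (dx_iter q u (x, t j)) _.[x]) (le_trans (ler_normD _ _))//.
  rewrite /M1 [B1 + _]addrC lerD//; last exact/uB/slabA.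
  by rewrite (le_trans uq)// ler_piMr// pow1.
have LhM j i x : good j -> cell_points (m j) A (i, x) ->
    forall q, `|((Lh j i)^`(q)).[x]| <= M2.
  move=> gj ixA; have [_ Ax] := ixA.
  apply: derivn_bound ((Lh_DG j).1 i) _ => q qk.
  have [_ _ /(_ q (i, x) qk ixA)/= Lq _] := gj.
  rewrite -(subrK (dx_iter q (dt_once u) (x, t j)) _.[x]).
  rewrite (le_trans (ler_normD _ _))//.
  rewrite /M2 [B2 + _]addrC lerD//.
    by rewrite (le_trans Lq)// ler_piMr// pow1.
  rewrite /dx_iter /dt_once /iter_derive -foldr_cat.
  by apply: (utB q) => //; exact: slabA.
(* With [good] built into the set, [D] is empty for indices where the asymptotic estimates fail, and
   bounds can be stated over all pairs of a discretization and a cell. *)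
pose D (ji : J * int) : set R :=
  [set x | [/\ good ji.1, A x & cell (m ji.1) ji.2 x]].
have uh_bd l : bounded_upto D l (fun ji => horner (uh ji.1 ji.2)).
  apply: (@bounded_upto_poly _ _ _ _ _ M1) => r [j i] x [gj Ax xi'].
  exact: uhM.
have Lh_bd l : bounded_upto D l (fun ji => horner (Lh ji.1 ji.2)).
  apply: (@bounded_upto_poly _ _ _ _ _ M2) => r [j i] x [gj Ax xi'].
  exact: LhM.
have v_bd l : bounded_upto D l (fun ji x => derive1 U (uh ji.1 ji.2).[x]).
  apply: (bounded_upto_comp (V := derive1 U)) => // r x.
  by rewrite -derive1Sn; exact: smooth_on_derivable.
(* Order [k+1] of [v] serves the Taylor remainder of the test function; order [2 * N - 2] of the
   product [v L_h] serves the quadrature error. *)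
have [V vV] := bounded_upto_bound (v_bd k.+1).
have g_bd l := bounded_uptoM (v_bd l) (Lh_bd l).
have [Q gQ] := bounded_upto_bound (g_bd (2 * N - 2)%N).
have [C0 fluxC0] := flux_estimates M1 f_C1 UF flux.
have [L0 fL0] := continuous_bounded M1 cf.
pose C := `|C0|; pose L := `|L0|.
have fluxC (r s : R) : `|r| <= M1 -> `|s| <= M1 ->
    [/\ `|fhat r s - f r| <= C * `|s - r|, `|fhat r s - f s| <= C * `|s - r|,
        `|Fhat r s - F r - derive1 U r * (fhat r s - f r)| <= C * `|s - r| ^+ 2 &
        `|Fhat r s - F s - derive1 U s * (fhat r s - f s)|
          <= C * `|s - r| ^+ 2].
  move=> rM sM; have CC (e : R) : 0 <= e -> C0 * e <= C * e.
    by move=> e0; rewrite ler_wpM2r// ler_norm.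
  have sr2 : 0 <= `|s - r| ^+ 2 by rewrite exprn_ge0.
  have [e1 e2 e3 e4] := fluxC0 r s rM sM.
  by split; apply: le_trans (CC _ _).
have fL (r s : R) : `|r| <= M1 -> `|s| <= M1 -> `|f s - f r| <= L * `|s - r|.
  move=> rM sM; apply: mvt_bound df1 _ => y rys.
  by rewrite (le_trans (fL0 _ (between_norm rM sM rys)))// ler_norm.
pose K := K1 + K2; pose E := K + L * K + `|V| + 2 * C * K.
pose W := \sum_(q < N) `|omega q|.
have W0 : 0 <= W by rewrite sumr_ge0.
(* The three summands come from the time expansion at the nodes, the quadrature error and the
   entropy production. *)
exists (W * `|K3| + (W + 1) * `|Q| + (4 * E ^+ 2 + 8 * C * K ^+ 2)).
apply: filterS near_good => j gj i iA.
have [dx1 near_u near_L near_U] := gj.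
have h0 : 0 < dx j := dx_gt0 j.
set h := dx j in dx1 near_u near_L near_U h0 *.
set a := edge (m j) i.
have aS : edge (m j) (i + 1) = a + h.
  by rewrite /a /edge intrD mulrDl mul1r addrA.
have cellE : cell (m j) i = `[a, a + h]%classic by rewrite /cell aS.
have inA x : a <= x <= a + h -> A x.
  by move=> xi'; apply: iA; rewrite cellE /= in_itv.
have pt x : a <= x <= a + h -> cell_points (m j) A (i, x).
  by move=> xi'; split; [rewrite /= cellE /= in_itv | exact: inA].
have inD x : a <= x <= a + h -> D (j, i) x.
  by move=> xi'; have [? ?] := pt x xi'; split.
have aI : a <= a <= a + h by rewrite lexx lerDl ltW.
have bI : a <= a + h <= a + h by rewrite lexx lerDl ltW.
(* The neighbouring cells may leave [A], but the outer traces are taken at end points of cell [i],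
   which lie in [A]; the assumptions therefore reach them. *)
have ptl : cell_points (m j) A (i - 1, a).
  split; last exact: inA.
  rewrite /= /cell subrK /= in_itv/= lexx andbT /a /edge lerD2l.
  by rewrite ler_wpM2r ?(ltW h0)// ler_int gerDl.
have ptr : cell_points (m j) A (i + 1, a + h).
  split; last exact: inA.
  rewrite /= /cell -aS /= in_itv/= lexx /edge lerD2l.
  by rewrite ler_wpM2r ?(ltW h0)// ler_int lerDl.
pose v x := derive1 U (uh j i).[x].
pose phi := taylor k.+1 v a.
have dv r (x : R) : derivable (derive1n r v) x 1.
  exact: (bounded_upto_derivable (i := (j, i)) (v_bd r.+1) (ltnSn r)).
have vV' x : a <= x <= a + h -> `|derive1n k.+1 v x| <= `|V|.
  move=> xI; rewrite (le_trans _ (ler_norm V))//.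
  exact: (vV (j, i) x (inD x xI)).
have h_eq : a + h - a = h by rewrite addrC addKr.
have phi_v x : a <= x <= a + h -> `|phi.[x] - v x| <= `|V| * h ^+ k.+1 /\
    `|phi^`().[x] - derive1n 2 U (uh j i).[x] * ((uh j i)^`()).[x]|
      <= `|V| * h ^+ k.
  move=> xI; split.
    rewrite distrC -[X in _ <= _ * X ^+ _]h_eq.
    exact: (taylor_bound (fun r x _ => dv r x) vV' xI).
  have [_ <-] := entropy_variable_derive (uh j i) x sU.
  rewrite -derive1E deriv_taylor distrC -[X in _ <= _ * X ^+ _]h_eq.
  apply: (taylor_bound _ _ xI) => [r y _|y yI].
    by rewrite -derive1Sn; exact: dv.
  by rewrite -derive1Sn; exact: vV'.
(* The same polynomial may be used on every cell, since the DG identity on cell [i] sees the test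
   function only there. *)
have phi_Vh : Vh k (fun=> phi) by move=> ?; exact: size_taylor.
have DG := (Lh_DG j).2 _ phi_Vh i.
rewrite /at_interface /trace_minus /trace_plus subrK aS -/a cellE in DG.
have K12 : 0 <= K1 <= K by rewrite K10 lerDl.
have powk : 0 <= h ^+ k.+1 by rewrite exprn_ge0 ?ltW.
have near_u0 ix : cell_points (m j) A ix ->
    `|(uh j ix.1).[ix.2] - u (ix.2, t j)| <= K * h ^+ k.+1.
  move=> /(near_u 0%N ix isT); rewrite subn0 addn1 => /le_trans; apply.
  by rewrite ler_wpM2r// lerDl.
have near_L0 ix : cell_points (m j) A ix ->
    `|(Lh j ix.1).[ix.2] - dt_once u (ix.2, t j)| <= K * h ^+ k.+1.
  move=> /(near_L 0%N ix isT); rewrite subn0 addn1 => /le_trans; apply.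
  by rewrite ler_wpM2r// lerDr.
have prod := @dg_entropy_production R f U F (fun x => u (x, t j))
  (fun x => dt_once u (x, t j)) fhat Fhat (uh j i) (Lh j i) phi a h
  (uh j (i - 1)).[a] (uh j (i + 1)).[a + h] M1 C L K `|V| k.
have {prod} prod : `|\int[lebesgue_measure]_(x in `[a, a + h]) (v x * (Lh j i).[x])
    + Fhat (uh j i).[a + h] (uh j (i + 1)).[a + h]
    - Fhat (uh j (i - 1)).[a] (uh j i).[a]|
    <= (4 * E ^+ 2 + 8 * C * K ^+ 2) * h ^+ (2 * k + 2).
  apply: prod; rewrite ?h0 ?dx1 ?addr_ge0 ?normr_ge0//.
  - apply: slice_continuous => x.
    exact: (smooth_on_slab x [:: ((0, 1) : R * R)] su (tT j)).
  - by move=> x; exact: (flux_derivative x f_C1 T_gt0 u_exact (tT j)).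
  - exact: (uhM _ _ _ gj ptl 0%N).
  - exact: (uhM _ _ _ gj ptr 0%N).
  - exact: (near_u0 _ ptl).
  - exact: (near_u0 _ ptr).
  - move=> x xI; split.
    + rewrite (le_trans (uB 0%N (x, t j) isT _)) ?lerDl//.
      exact/slabA/inA.
    + exact: (uhM _ _ _ gj (pt x xI) 0%N).
    + exact: (near_u0 _ (pt x xI)).
    + exact: (near_L0 _ (pt x xI)).
have n0 : (0 < 2 * N - 2)%N.
  rewrite subn_gt0 (leq_trans _ kN)//.
  by rewrite addnC.
have quad := @gauss_lobatto_error R N xi omega (fun x => v x * (Lh j i).[x])
  a h `|Q| n0 GL h0.
have {quad} quad := quad
  (bounded_upto_derivable (i := (j, i)) (g_bd (2 * N - 2)%N))
  (fun x xI => le_trans (gQ (j, i) x (inD x xI)) (ler_norm Q)).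
have nodes : `|\sum_(q < N) omega q *
    (U (euler_step (dt j) (uh j) (Lh j) i).[a + h * xi q]
     - U (uh j i).[a + h * xi q]
     - dt j * (v (a + h * xi q) * (Lh j i).[a + h * xi q]))|
    <= W * `|K3| * dt j ^+ 2.
  rewrite (le_trans (ler_norm_sum _ _ _))// -mulrA mulr_suml ler_sum// => q _.
  rewrite normrM ler_wpM2l//.
  have /andP[q0 q1] := gauss_lobatto_node q GL.
  have xqI : a <= a + h * xi q <= a + h.
    by rewrite lerDl lerD2l mulr_ge0 ?(ltW h0)//= ler_piMr ?(ltW h0).
  apply: (le_trans (near_U _ (pt _ xqI))).
  by rewrite ler_wpM2r ?ler_norm// sqr_ge0.
rewrite /U_high /U_up /cell_entropy /cell_quadrature /at_interface.
rewrite /trace_minus /trace_plus subrK aS -/a -[mesh_size (m j)]/h.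
rewrite !mulKf ?gt_eqF//.
set S0 := \sum_(q < N) _ in nodes.
set S1 := \sum_(q < N) _ in quad.
set FR := Fhat _ _ in prod *; set FL := Fhat _ _ in prod *.
set I0 := Rintegral _ _ _ in prod quad.
(* Adding and subtracting the exact integral [I0] separates the time expansion error [S0], the
   quadrature error and the entropy production. The factor [dt j / h] costs the last two one power
   of [h]. *)
rewrite (_ : _ - _ = S0 + dt j / h * ((h * S1 - I0) + (I0 + FR - FL))); last first.
  have -> : dt j / h * ((h * S1 - I0) + (I0 + FR - FL)) =
      dt j * S1 + dt j / h * (FR - FL).
    by field; rewrite gt_eqF.
  rewrite /S0 /S1 mulr_sumr addrA -big_split/= opprB addrCA addrC; congr (_ + _).
  rewrite -sumrB; apply: eq_bigr => q _; ring.
have dth0 : 0 <= dt j / h by rewrite divr_ge0// ltW.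
rewrite (le_trans (ler_normD _ _))// normrM (ger0_norm dth0).
rewrite (le_trans (lerD nodes (ler_wpM2l dth0 (le_trans (ler_normD _ _)
  (lerD quad prod)))))//.
rewrite -/W.
set c1 := W * `|K3|; set c2 := (W + 1) * `|Q|; set c3 := 4 * E ^+ 2 + _.
have -> : dt j / h * (c2 * h ^+ (2 * N - 2) * h + c3 * h ^+ (2 * k + 2)) =
    c2 * (h ^+ (2 * N - 2) * dt j) + c3 * (h ^+ (2 * k + 1) * dt j).
  rewrite [(2 * k + 2)%N]addnS exprSr.
  by field; rewrite gt_eqF.
have c10 : 0 <= c1 by rewrite mulr_ge0.
have c20 : 0 <= c2 by rewrite mulr_ge0// addr_ge0.
have c30 : 0 <= c3.
  apply: addr_ge0; apply: mulr_ge0; rewrite ?sqr_ge0//.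
  by apply: mulr_ge0 => //; exact: normr_ge0.
have p1 : 0 <= h ^+ (2 * N - 2) * dt j by rewrite mulr_ge0 ?exprn_ge0 ?ltW.
have p2 : 0 <= h ^+ (2 * k + 1) * dt j by rewrite mulr_ge0 ?exprn_ge0 ?ltW.
have p3 : 0 <= dt j ^+ 2 by exact: sqr_ge0.
(* Each constant multiplies the full sum of the three nonnegative orders, which dominates the one it
   belongs to. *)
clearbody c1 c2 c3; rewrite 2!mulrDl -[leRHS]addrA.
by apply: lerD; [|apply: lerD]; apply: ler_wpM2l => //; lra.
Qed.
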